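(* Let $\mathbf L_1$ and $\mathbf L_2$ be sup-semilattices, let $f\colon \mathbf L_1\to \mathbf L_2$ be a homomorphism of sup-semilattices and let $\mathbf J=(T,S)$ be a frame. Then there exists a homomorphism of $F$-sup-semilattices $f^{\mathbf J}\colon \mathbf L_1^{\mathbf J}\to \mathbf L_2^{\mathbf J}$ such that, for every $x\in L_1^T$ and every $i\in T$, $(f^{\mathbf J}(x))(i)=f(x(i))$. Moreover, $-^{\mathbf J}$ (sending $\mathbf L$ to $\mathbf L^{\mathbf J}$ and $f$ to $f^{\mathbf J}$) is a functor from the category of sup-semilattices to the category of $F$-sup-semilattices and homomorphisms of $F$-sup-semilattices.
   Context: A sup-semilattice $\mathbf L=(L,\bigvee)$ is a poset in which every subset has a join; homomorphisms (morphisms) of sup-semilattices are maps preserving arbitrary joins. An $F$-sup-semilattice is a pair $(\mathbf G,F)$ where $\mathbf G$ is a sup-semilattice and $F\colon G\to G$ satisfies $F(\bigvee X)=\bigvee F(X)$ for all $X\subseteq G$. A homomorphism of $F$-sup-semilattices $(\mathbf G_1,F_1)\to(\mathbf G_2,F_2)$ is a sup-semilattice morphism $f$ with $F_2(f(x))=f(F_1(x))$ for all $x\in G_1$. A frame $\mathbf J=(T,S)$ is a set $T$ with a binary relation $S\subseteq T^2$. For a sup-semilattice $\mathbf L$ and a frame $\mathbf J=(T,S)$, $\mathbf L^{\mathbf J}$ is the $F$-sup-semilattice $(\mathbf L^T,F^{\mathbf J})$, where $\mathbf L^T$ is the set of maps $T\to L$ with pointwise order and $(F^{\mathbf J}(x))(i)=\bigvee\{x(k)\mid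 (i,k)\in S\}$ for $x\in L^T$, $i\in T$. *)

(* Defs.v *)
From HB Require Import structures.
From mathcomp Require Import all_boot all_order.
From mathcomp Require Import boolp classical_sets.

Set Implicit Arguments.
Unset Strict Implicit.
Unset Printing Implicit Defensive.

Import Order.TTheory.
Local Open Scope classical_set_scope.

Reserved Notation "{ 'supmorphism' U -> V }"
  (at level 0, U at level 98, V at level 99,
   format "{ 'supmorphism'  U  ->  V }").
Reserved Notation "{ 'fsupmorphism' U -> V }"
  (at level 0, U at level 98, V at level 99,
   format "{ 'fsupmorphism'  U  ->  V }").

(* The join operation is uniquely determined by the order. *)
HB.mixin Record POrder_isSupSemilattice d L & Order.POrder d L := {
  bigjoin : set L -> L;
  bigjoinP : forall X : set L, isLub X (bigjoin X)
}.

#[short(type="supSemilatticeType")]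
HB.structure Definition SupSemilattice d :=
  { L of POrder_isSupSemilattice d L & Order.POrder d L }.

HB.mixin Record isSupMorphism d1 (L1 : supSemilatticeType d1)
    d2 (L2 : supSemilatticeType d2) (f : L1 -> L2) := {
  supmorphism_bigjoin : forall X : set L1, f (bigjoin X) = bigjoin (f @` X)
}.

#[short(type="supMorphism")]
HB.structure Definition SupMorphism d1 (L1 : supSemilatticeType d1)
  d2 (L2 : supSemilatticeType d2) := { f of isSupMorphism d1 L1 d2 L2 f }.

Notation "{ 'supmorphism' U -> V }" := (supMorphism U%type V%type) : type_scope.

HB.mixin Record SupSemilattice_isFSupSemilattice d G & SupSemilattice d G := {
  Fop : G -> G;
  Fop_bigjoin : forall X : set G, Fop (bigjoin X) = bigjoin (Fop @` X)
}.

#[short(type="fSupSemilatticeType")]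
HB.structure Definition FSupSemilattice d :=
  { G of SupSemilattice_isFSupSemilattice d G & SupSemilattice d G }.

HB.mixin Record isFCommuting d1 (G1 : fSupSemilatticeType d1)
    d2 (G2 : fSupSemilatticeType d2) (f : G1 -> G2) := {
  fsupmorphism_Fop : forall x : G1, Fop (f x) = f (Fop x)
}.

#[short(type="fSupMorphism")]
HB.structure Definition FSupMorphism d1 (G1 : fSupSemilatticeType d1)
  d2 (G2 : fSupSemilatticeType d2) :=
  { f of isSupMorphism d1 G1 d2 G2 f & isFCommuting d1 G1 d2 G2 f }.

Notation "{ 'fsupmorphism' U -> V }" := (fSupMorphism U%type V%type)
  : type_scope.

Lemma isLub_inj d (L : porderType d) (X : set L) (a b : L) :
  isLub X a -> isLub X b -> a = b.
Proof.
move=> [ua la] [ub lb]; apply/eqP.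
by rewrite eq_le la// lb.
Qed.

Lemma bigjoin_eq d (L : supSemilatticeType d) (X : set L) (a : L) :
  isLub X a -> bigjoin X = a.
Proof. exact: isLub_inj (bigjoinP X). Qed.

Lemma supmorphism_ext d1 (L1 : supSemilatticeType d1)
    d2 (L2 : supSemilatticeType d2) (f g : {supmorphism L1 -> L2}) :
  f =1 g -> f = g.
Proof.
case: f g => [f [[pf]]] [g [[pg]]] /= /funext fg.
by case: _ / fg in pg *; rewrite (Prop_irrelevance pf pg).
Qed.

Lemma fsupmorphism_ext d1 (G1 : fSupSemilatticeType d1)
    d2 (G2 : fSupSemilatticeType d2) (f g : {fsupmorphism G1 -> G2}) :
  f =1 g -> f = g.
Proof.
case: f g => [f [[pf] [qf]]] [g [[pg] [qg]]] /= /funext fg.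
case: _ / fg in pg qg *.
by rewrite (Prop_irrelevance pf pg) (Prop_irrelevance qf qg).
Qed.

Section IdComp.
Context d1 (L1 : supSemilatticeType d1) d2 (L2 : supSemilatticeType d2)
  d3 (L3 : supSemilatticeType d3).
Variables (g : {supmorphism L2 -> L3}) (f : {supmorphism L1 -> L2}).

Fact idfun_bigjoin (X : set L1) : idfun (bigjoin X) = bigjoin (idfun @` X).
Proof. by rewrite image_id. Qed.

HB.instance Definition _ := isSupMorphism.Build d1 L1 d1 L1 idfun idfun_bigjoin.

Fact comp_bigjoin (X : set L1) : (g \o f) (bigjoin X) = bigjoin ((g \o f) @` X).
Proof. by rewrite /= !supmorphism_bigjoin image_comp. Qed.

HB.instance Definition _ :=
  isSupMorphism.Build d1 L1 d3 L3 (g \o f) comp_bigjoin.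

End IdComp.

Section FIdComp.
Context d1 (G1 : fSupSemilatticeType d1) d2 (G2 : fSupSemilatticeType d2)
  d3 (G3 : fSupSemilatticeType d3).
Variables (g : {fsupmorphism G2 -> G3}) (f : {fsupmorphism G1 -> G2}).

Fact idfun_Fop (x : G1) : Fop (idfun x) = idfun (Fop x).
Proof. by []. Qed.

HB.instance Definition _ := isFCommuting.Build d1 G1 d1 G1 idfun idfun_Fop.

Fact comp_Fop (x : G1) : Fop ((g \o f) x) = (g \o f) (Fop x).
Proof. by rewrite /= !fsupmorphism_Fop. Qed.

HB.instance Definition _ := isFCommuting.Build d1 G1 d3 G3 (g \o f) comp_Fop.

End FIdComp.

Record frame := Frame {
  frame_pt :> Type;
  frame_rel : frame_pt -> frame_pt -> Prop
}.

(* An alias of J -> L: the frame relation, which determines the operator Fop,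
   can not be inferred from the bare function type. The order is the pointwise
   order on functions provided by boolp. *)
Definition power (L : Type) (J : frame) : Type := J -> L.

Section Power.
Context d (L : supSemilatticeType d) (J : frame).

HB.instance Definition _ := Order.POrder.copy (power L J) (J -> L).

Definition power_bigjoin (X : set (power L J)) : power L J :=
  fun i => bigjoin [set x i | x in X].

Fact power_bigjoinP (X : set (power L J)) : isLub X (power_bigjoin X).
Proof.
split=> [x Xx|y uy]; apply/asboolP => i.
- by case: (bigjoinP [set x i | x in X]) => + _; apply; exists x.
- case: (bigjoinP [set x i | x in X]) => _; apply => _ [x Xx <-].
  by have /asboolP := uy _ Xx; apply.
Qed.

HB.instance Definition _ :=
  POrder_isSupSemilattice.Build _ (power L J) power_bigjoinP.

Definition power_Fop (x : power L J) : power L J :=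
  fun i => bigjoin [set x k | k in [set k | frame_rel i k]].

Fact power_Fop_bigjoin (X : set (power L J)) :
  power_Fop (bigjoin X) = bigjoin (power_Fop @` X).
Proof.
apply/funext => i; apply: bigjoin_eq; split.
- move=> _ [k Sik <-]; rewrite {1}/bigjoin /= /power_bigjoin.
  case: (bigjoinP [set x k | x in X]) => _; apply => _ [x Xx <-].
  case: (bigjoinP [set y i | y in power_Fop @` X]) => /(_ (power_Fop x i)) h _.
  apply: le_trans (h _); last by exists (power_Fop x) => //; exists x.
  by case: (bigjoinP [set x k | k in [set k | frame_rel i k]]) => + _; apply; exists k.
- move=> b ub; case: (bigjoinP [set y i | y in power_Fop @` X]) => _; apply.
  move=> _ [_ [x Xx <-] <-].
  case: (bigjoinP [set x k | k in [set k | frame_rel i k]]) => _; apply.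
  move=> _ [k Sik <-]; apply: le_trans (ub (bigjoin X k) _); last by exists k.
  by case: (bigjoinP [set x k | x in X]) => + _; apply; exists x.
Qed.

HB.instance Definition _ :=
  SupSemilattice_isFSupSemilattice.Build _ (power L J) power_Fop_bigjoin.

End Power.

Record category := Category {
  object :> Type;
  hom : object -> object -> Type;
  idhom : forall a, hom a a;
  comphom : forall a b c, hom b c -> hom a b -> hom a c;
  comphomA : forall a b c d (h : hom c d) (g : hom b c) (f : hom a b),
    comphom h (comphom g f) = comphom (comphom h g) f;
  comp1hom : forall a b (f : hom a b), comphom (idhom b) f = f;
  comphom1 : forall a b (f : hom a b), comphom f (idhom a) = f
}.

Record is_functor (C D : category) (F0 : C -> D)
    (F1 : forall a b : C, hom a b -> hom (F0 a) (F0 b)) : Prop := IsFunctor {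
  functor_id : forall a : C, F1 a a (idhom a) = idhom (F0 a);
  functor_comp : forall (a b c : C) (g : hom b c) (f : hom a b),
    F1 a c (comphom g f) = comphom (F1 b c g) (F1 a b f)
}.

Arguments is_functor : clear implicits.

(* The display is a mere notational tag: Order.disp_t has a single element. *)
Record supObject := SupObject {
  sup_disp : Order.disp_t;
  sup_sort :> supSemilatticeType sup_disp
}.

Record fSupObject := FSupObject {
  fsup_disp : Order.disp_t;
  fsup_sort :> fSupSemilatticeType fsup_disp
}.

Definition supCategory : category.
Proof.
refine (@Category supObject (fun L1 L2 => {supmorphism L1 -> L2})
  (fun L => idfun : {supmorphism L -> L})
  (fun L1 L2 L3 g f => (g \o f) : {supmorphism L1 -> L3}) _ _ _).
all: by move=> *; apply: supmorphism_ext.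
Defined.

Definition fSupCategory : category.
Proof.
refine (@Category fSupObject (fun G1 G2 => {fsupmorphism G1 -> G2})
  (fun G => idfun : {fsupmorphism G -> G})
  (fun G1 G2 G3 g f => (g \o f) : {fsupmorphism G1 -> G3}) _ _ _).
all: by move=> *; apply: fsupmorphism_ext.
Defined.

Definition power_object (J : frame) (L : supObject) : fSupObject :=
  FSupObject (power L J).

(* Main.v *)
Require Import Defs.
From HB Require Import structures.
From mathcomp Require Import all_boot all_order.
From mathcomp Require Import boolp classical_sets.

(** The map is post-composition with [f]. In a power, joins are taken coordinatewise, and [Fop] at
    [i] is itself a join in the base of coordinates. Hence preservation of joins by [f] yields both
    [power_map_bigjoin] and [power_map_Fop]. Post-composition respects identities and composites by
    computation, which gives functoriality. *)

Definition power_map {d1 d2} {L1 : supSemilatticeType d1}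
    {L2 : supSemilatticeType d2} (J : frame) (f : L1 -> L2) :
  power L1 J -> power L2 J := fun x i => f (x i).

Section PowerMap.
Context {d1 d2 : Order.disp_t} {L1 : supSemilatticeType d1}
  {L2 : supSemilatticeType d2} (J : frame) (f : {supmorphism L1 -> L2}).

Fact power_map_bigjoin (X : set (power L1 J)) :
  power_map J f (bigjoin X) = bigjoin (power_map J f @` X)%classic.
Proof.
(* By conversion, the join of the power is unfolded to a join in [L1] that [f] can be moved
   through. *)
apply/funext => i; transitivity (f (power_bigjoin X i)) => //.
rewrite /power_bigjoin supmorphism_bigjoin [RHS]/bigjoin /= /power_bigjoin.
by rewrite !image_comp.
Qed.

Fact power_map_Fop (x : power L1 J) :
  Fop (power_map J f x) = power_map J f (Fop x).
Proof.
apply/funext => i; transitivity (power_Fop (power_map J f x) i) => //.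
transitivity (f (power_Fop x i)) => //.
(* Both sides become the join of the [f (x k)] with [frame_rel i k]. *)
by rewrite /power_Fop supmorphism_bigjoin image_comp.
Qed.

HB.instance Definition _ := isSupMorphism.Build _ (power L1 J) _ (power L2 J)
  (power_map J f) power_map_bigjoin.
HB.instance Definition _ := isFCommuting.Build _ (power L1 J) _ (power L2 J)
  (power_map J f) power_map_Fop.

Definition power_hom : {fsupmorphism power L1 J -> power L2 J} := power_map J f.

End PowerMap.

Theorem theorem3p3 (J : frame) :
  (forall (d1 d2 : Order.disp_t)
      (L1 : supSemilatticeType d1) (L2 : supSemilatticeType d2)
      (f : {supmorphism L1 -> L2}),
    exists fJ : {fsupmorphism power L1 J -> power L2 J},
      forall (x : power L1 J) (i : J), fJ x i = f (x i))
  /\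
  (exists powJ : forall L1 L2 : supCategory,
      {supmorphism L1 -> L2} -> {fsupmorphism power L1 J -> power L2 J},
    (forall (L1 L2 : supCategory) (f : {supmorphism L1 -> L2})
        (x : power L1 J) (i : J), powJ L1 L2 f x i = f (x i))
    /\ is_functor supCategory fSupCategory (power_object J) powJ).
Proof.
split=> [d1 d2 L1 L2 f|]; first by exists (power_hom J f).
exists (fun L1 L2 => power_hom J); split=> //.
(* Morphisms are equal once their underlying functions agree, and here these are convertible. *)
by split=> *; apply: fsupmorphism_ext.
Qed.
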